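(* Let $f:X\subseteq\{0,1\}^n\to\mathbb{R}$, let $\mathcal{L}:=\{(0,\mathbf 0)\}\cup\{(1,x)\mid x\in X\}\subseteq\{0,1\}^{n+1}$, and let $F:\mathcal{L}\to\mathbb{R}$ be its lift, defined by $F(0,\mathbf 0)=0$ and $F(1,x)=f(x)$ for $x\in X$. Then $$\operatorname{conv}(f)(x)=\operatorname{sconv}(F)(1,x)\qquad\text{for all }x\in\operatorname{conv}(X).$$
   Context: $\operatorname{conv}(f)$ is the convex envelope of $f$: the largest convex function on $\operatorname{conv}(X)$ that is $\le f$ on $X$. A function $p$ on a convex cone is sublinear if $p(rx)=rp(x)$ for $r\ge0$ and $p(x+y)\le p(x)+p(y)$. For $F:S\to\mathbb{R}$, the sublinear envelope $\operatorname{sconv}(F)$ is the largest sublinear function on $\operatorname{cone}(S)$ (the convex conic hull of $S$) that is $\le F$ on $S$. *)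

(* Defs.v *)
From HB Require Import structures.
From mathcomp Require Import all_boot all_order all_algebra.
From mathcomp Require Import boolp classical_sets reals convex.

Set Implicit Arguments.
Unset Strict Implicit.
Unset Printing Implicit Defensive.

Import Order.TTheory GRing.Theory Num.Theory.

Local Open Scope classical_set_scope.
Local Open Scope ring_scope.

(* A real function on a subset D of E is represented by a total function
   E -> R, of which only the values on D matter. *)

Definition convex_hull (R : realType) (E : lmodType R) (X : set E) : set E :=
  smallest (@convex_set R E) X.

Definition convex_cone (R : realType) (E : lmodType R) (K : set E) : Prop :=
  [/\ K 0,
      forall (r : R) (x : E), 0 <= r -> K x -> K (r *: x)
    & forall x y : E, K x -> K y -> K (x + y)].

Definition conic_hull (R : realType) (E : lmodType R) (S : set E) : set E :=
  smallest (@convex_cone R E) S.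

Definition sublinear_on (R : realType) (E : lmodType R) (K : set E)
    (p : E -> R) : Prop :=
  (forall (r : R) (x : E), 0 <= r -> K x -> p (r *: x) = r * p x) /\
  (forall x y : E, K x -> K y -> p (x + y) <= p x + p y).

Definition is_largest_on (R : realType) (E : lmodType R) (D : set E)
    (C : set (E -> R)) (g : E -> R) : Prop :=
  C g /\ forall h, C h -> forall x, D x -> h x <= g x.

(* The largest element of C, which is unique only as a function on D; the
   default value 0 is a junk value, used only if there is no largest element. *)
Definition largest_on (R : realType) (E : lmodType R) (D : set E)
    (C : set (E -> R)) : E -> R :=
  xget (fun=> 0) [set g | is_largest_on D C g].

Definition conv_env (R : realType) (E : lmodType R) (X : set E)
    (f : E -> R) : E -> R :=
  largest_on (convex_hull X)
    [set g | convex_function (convex_hull X) g /\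
             forall x, X x -> g x <= f x].

Definition sconv_env (R : realType) (E : lmodType R) (S : set E)
    (F : E -> R) : E -> R :=
  largest_on (conic_hull S)
    [set p | sublinear_on (conic_hull S) p /\
             forall y, S y -> p y <= F y].

Definition binary_points (R : realType) (n : nat) : set 'rV[R]_n :=
  [set x | forall i, x ord0 i = 0 \/ x ord0 i = 1].

(* The vector (t, x) of R^(n+1). *)
Definition lift_point (R : realType) (n : nat) (t : R) (x : 'rV[R]_n) :
    'rV[R]_(1 + n) :=
  row_mx t%:M x.

Definition lift_domain (R : realType) (n : nat) (X : set 'rV[R]_n) :
    set 'rV[R]_(1 + n) :=
  [set lift_point 0 0] `|` [set lift_point 1 x | x in X].

(* Main.v *)
Require Import Defs.
From HB Require Import structures.
From mathcomp Require Import all_boot all_order all_algebra.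
From mathcomp Require Import boolp classical_sets reals convex.
From mathcomp Require Import interval_inference.

Set Implicit Arguments.
Unset Strict Implicit.
Unset Printing Implicit Defensive.

Import Order.TTheory GRing.Theory Num.Theory.

Local Open Scope classical_set_scope.
Local Open Scope ring_scope.

(** Sublinear functions on the cone over [conv X], placed at height 1, are
    the same thing as convex functions on [conv X].  A sublinear [p] restricts
    to the convex function [x |-> p (1, x)], and a convex [g] extends to its
    perspective [(t, x) |-> t * g (x / t)], which is sublinear; for [s, t > 0]
    subadditivity of the perspective at [(s, s x)] and [(t, t y)] is convexity
    of [g] with the weights [s / (s + t)] and [t / (s + t)]
    ([perspective_sublinear]).  The two operations are mutually inverse, are
    monotone, and match minorants of the lift of [f] with minorants of [f].
    Hence the perspective of the largest convex minorant of [f] is the largest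
    sublinear minorant of the lift ([perspective_is_largest]), and it takes the
    value of the convex envelope at [(1, x)].

    The envelopes are defined by choice with a junk default, so a largest
    convex minorant has to be produced ([conv_env_is_largest]): it is the
    pointwise supremum of all convex minorants.  There is one, because a
    function on the finite set [X] is bounded below, and the supremum is finite
    because the points at which all minorants have a common upper bound form a
    convex set containing [X].  On the sublinear side, the perspective itself
    is the largest element. *)

(** * Convex combinations with unnormalised weights *)

Section Combinations.
Variables (R : realType) (E : lmodType R).
Implicit Types (D : set E) (f g : E -> R).

Lemma convex_setP D : convex_set D <->
  forall (l : {i01 R}) x y, D x -> D y -> D (l%:num *: x + (1 - l%:num) *: y).
Proof.
split=> cD => [l x y Dx Dy|x y l /set_mem Dx /set_mem Dy].
  exact: set_mem (cD x y l (mem_set Dx) (mem_set Dy)).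
by apply/mem_set; exact: cD.
Qed.

Lemma convex_functionP D g : convex_function D g <->
  forall (l : {i01 R}) x y, D x -> D y ->
    g (l%:num *: x + (1 - l%:num) *: y) <= l%:num * g x + (1 - l%:num) * g y.
Proof.
split=> cg l x y => [Dx Dy|/set_mem Dx /set_mem Dy]; last exact: cg.
exact: cg l x y (mem_set Dx) (mem_set Dy).
Qed.

Lemma normalized_weights (s t : R) : 0 < s -> 0 < t ->
  exists2 l : {i01 R}, l%:num = (s + t)^-1 * s & 1 - l%:num = (s + t)^-1 * t.
Proof.
move=> s0 t0; have st0 : 0 < s + t by rewrite addr_gt0.
have l0 : 0 <= (s + t)^-1 * s by rewrite mulr_ge0 ?invr_ge0 ?ltW.
have l1 : (s + t)^-1 * s <= 1 by rewrite ler_pdivrMl// mulr1 lerDl ltW.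
exists (Itv01 l0 l1) => //=.
by rewrite -{1}(mulVf (lt0r_neq0 st0)) -mulrBr [s + t]addrC addrK.
Qed.

(** Positive weights that need not sum to 1 are the form in which a cone sees
    convexity: the points at heights [s] and [t] add up to one at height
    [s + t]. *)
Lemma convex_set_weighted D (s t : R) (x y : E) :
  convex_set D -> 0 < s -> 0 < t -> D x -> D y ->
  D ((s + t)^-1 *: (s *: x + t *: y)).
Proof.
move=> cD s0 t0 Dx Dy; have [l ls lt] := normalized_weights s0 t0.
move/convex_setP : cD => /(_ l x y Dx Dy).
by rewrite lt ls scalerDr !scalerA.
Qed.

Lemma convex_function_weighted D g (s t : R) (x y : E) :
  convex_function D g -> 0 < s -> 0 < t -> D x -> D y ->
  (s + t) * g ((s + t)^-1 *: (s *: x + t *: y)) <= s * g x + t * g y.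
Proof.
move=> cg s0 t0 Dx Dy; have [l ls lt] := normalized_weights s0 t0.
move/convex_functionP : cg => /(_ l x y Dx Dy).
rewrite lt ls scalerDr !scalerA -!mulrA -mulrDr.
by rewrite ler_pdivlMl// addr_gt0.
Qed.

(** * The convex envelope *)

Lemma convex_hull_convex (X : set E) : convex_set (convex_hull X).
Proof.
apply/convex_setP => l x y Hx Hy A AX; have [/convex_setP cA _] := AX.
by apply: cA; [exact: Hx|exact: Hy].
Qed.

(** The points of the hull at which the convex minorants have a common upper
    bound form a convex set, since such bounds can be averaged, and [f z] is
    one at each [z] in [X]; minimality of the hull does the rest. *)
Lemma convex_minorants_bounded (X : set E) f x : convex_hull X x ->
  exists M, forall g, convex_function (convex_hull X) g ->
    (forall z, X z -> g z <= f z) -> g x <= M.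
Proof.
move=> Hx.
pose B : set E := [set z | convex_hull X z /\ exists M, forall g,
  convex_function (convex_hull X) g ->
  (forall z, X z -> g z <= f z) -> g z <= M].
suff /(_ x Hx)[//] : convex_hull X `<=` B.
apply: smallest_sub => [|z Xz].
  apply/convex_setP => l y z [Hy [M hM]] [Hz [N hN]]; split.
    by move/convex_setP : (@convex_hull_convex X); exact.
  exists (l%:num * M + (1 - l%:num) * N) => g cg gf.
  move/convex_functionP : (cg) => /(_ l y z Hy Hz)/le_trans; apply.
  by apply: lerD; apply: ler_wpM2l; rewrite ?subr_ge0 ?hM ?hN.
by split; [exact: sub_gen_smallest|exists (f z) => g _; exact].
Qed.

Lemma largest_onP (D : set E) (C : set (E -> R)) g :
  is_largest_on D C g -> is_largest_on D C (largest_on D C).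
Proof. exact: xgetI. Qed.

Lemma largest_on_eq (D : set E) (C : set (E -> R)) g x :
  is_largest_on D C g -> D x -> largest_on D C x = g x.
Proof.
move=> gmax Dx; have [Cl lmax] := largest_onP gmax; have [Cg gl] := gmax.
by apply/eqP; rewrite eq_le gl// lmax.
Qed.

(** A lower bound of [f] is a constant, hence convex, minorant: it makes the
    supremum of the convex minorants a supremum over a nonempty family. *)
Lemma conv_env_is_largest (X : set E) f (m : R) :
  (forall x, X x -> m <= f x) ->
  is_largest_on (convex_hull X)
    [set g | convex_function (convex_hull X) g /\
             forall x, X x -> g x <= f x] (conv_env X f).
Proof.
move=> mf; set C := [set g | _].
have Cm : C (fun=> m).
  split=> //; apply/convex_functionP => l x y _ _.
  by rewrite -mulrDl addrC subrK mul1r.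
pose V x : set R := [set g x | g in C].
have V0 x : V x !=set0 by exists m, (fun=> m).
have Vub x : convex_hull X x -> has_ubound (V x).
  move=> /(@convex_minorants_bounded _ f)[M hM].
  by exists M => _ [g [cg gf] <-]; exact: hM.
have Vsup g x : C g -> convex_hull X x -> g x <= sup (V x).
  by move=> Cg /Vub/ub_le_sup; apply; exists g.
apply: (@largest_onP _ _ (fun x => sup (V x))); split=> [|g Cg x]; last first.
  exact: Vsup.
split=> [|x Xx].
  apply/convex_functionP => l x y Hx Hy; apply: ge_sup => // _ [g Cg <-].
  have [/convex_functionP/(_ l x y Hx Hy)/le_trans cg _] := Cg; apply: cg.
  by apply: lerD; apply: ler_wpM2l; rewrite ?subr_ge0 ?Vsup.
by apply: ge_sup => // _ [g [_ gf] <-]; exact: gf.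
Qed.

End Combinations.

Lemma binary_points_bounded_below (R : realType) (n : nat)
    (f : 'rV[R]_n -> R) :
  exists m, forall x, binary_points x -> m <= f x.
Proof.
pose pt (b : 'rV[bool]_n) : 'rV[R]_n := map_mx (fun c : bool => c%:R) b.
exists (\big[Num.min/0]_b f (pt b)) => x binx.
suff -> : x = pt (map_mx (fun c => c == 1) x) by exact: bigmin_le.
by apply/rowP => i; rewrite !mxE; case: (binx i) => ->;
  rewrite ?eqxx// eq_sym oner_eq0.
Qed.

(** * The cone over a convex hull *)

Section Cone.
Variables (R : realType) (n : nat).
Implicit Types (X : set 'rV[R]_n) (f g : 'rV[R]_n -> R).
Implicit Types (p : 'rV[R]_(1 + n) -> R).

Lemma lift_pointZ (r t : R) (x : 'rV[R]_n) :
  r *: lift_point t x = lift_point (r * t) (r *: x).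
Proof. by rewrite /lift_point scale_row_mx scale_scalar_mx. Qed.

Lemma lift_pointD (s t : R) (x y : 'rV[R]_n) :
  lift_point s x + lift_point t y = lift_point (s + t) (x + y).
Proof. by rewrite /lift_point add_row_mx -raddfD. Qed.

Lemma lift_point00 : lift_point 0 0 = 0 :> 'rV[R]_(1 + n).
Proof. by rewrite /lift_point raddf0 row_mx0. Qed.

Lemma conic_hull_cone (S : set 'rV[R]_(1 + n)) : convex_cone (conic_hull S).
Proof.
split=> [A [[A0 _ _] _]//|r x r0 Sx A AS|x y Sx Sy A AS].
  by have [[_ AZ _] _] := AS; apply: AZ => //; exact: Sx.
by have [[_ _ AD] _] := AS; apply: AD; [exact: Sx|exact: Sy].
Qed.

(** Minimality of the convex hull applied to the slice of the cone at
    height 1. *)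
Lemma conic_hull_lift X x :
  convex_hull X x -> conic_hull (lift_domain X) (lift_point 1 x).
Proof.
have [_ KZ KD] := conic_hull_cone (lift_domain X).
suff H : convex_hull X `<=`
    [set z | conic_hull (lift_domain X) (lift_point 1 z)] by move=> /H.
apply: smallest_sub => [|z Xz].
  apply/convex_setP => l y z Ky Kz /=.
  rewrite -[X in lift_point X](subrKC l%:num) -lift_pointD.
  rewrite -{1}[l%:num]mulr1 -{1}[1 - l%:num]mulr1 -!lift_pointZ.
  by apply: KD; apply: KZ => //; rewrite subr_ge0.
by apply: sub_gen_smallest; right; exists z.
Qed.

(** Every point of the cone other than the apex lies on a ray through the
    hull at height 1, so a sublinear function on the cone is determined by its
    values at height 1. *)
Lemma conic_hull_liftE X y : conic_hull (lift_domain X) y ->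
  y = lift_point 0 0 \/
  exists t x, [/\ 0 < t, convex_hull X x & y = t *: lift_point 1 x].
Proof.
move: y; apply: smallest_sub => [|_ [->|[x Xx <-]]]; last 2 first.
- by left.
- right; exists 1, x; rewrite scale1r; split=> //.
  exact: sub_gen_smallest.
split=> [|r _ r0 [->|[t [x [t0 Hx ->]]]]|_ y [->|[s [x [s0 Hx ->]]]]].
- by left; rewrite lift_point00.
- by left; rewrite lift_point00 scaler0.
- have [->|r_neq0] := eqVneq r 0; first by left; rewrite scale0r lift_point00.
  right; exists (r * t), x; rewrite scalerA; split=> //.
  by rewrite mulr_gt0// lt0r r_neq0.
- by rewrite lift_point00 add0r.
- move=> [->|[t [z [t0 Hz ->]]]]; right.
    by exists s, x; rewrite lift_point00 addr0.
  have st0 : 0 < s + t by rewrite addr_gt0.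
  exists (s + t), ((s + t)^-1 *: (s *: x + t *: z)); split=> //.
    exact: convex_set_weighted (@convex_hull_convex _ _ X) s0 t0 Hx Hz.
  rewrite !lift_pointZ lift_pointD scalerA divff ?scale1r ?mulr1//.
  exact: lt0r_neq0.
Qed.

(** * The perspective of a convex function *)

(** With [y = (t, x)] this is [t * g (x / t)].  At [t = 0] the factor [t]
    absorbs the junk inverse and gives the value [0] at the apex. *)
Definition perspective g : 'rV[R]_(1 + n) -> R :=
  fun y => lsubmx y 0 0 * g ((lsubmx y 0 0)^-1 *: rsubmx y).

Lemma perspective_lift g t x :
  perspective g (lift_point t x) = t * g (t^-1 *: x).
Proof.
by rewrite /perspective /lift_point row_mxKl row_mxKr mxE eqxx mulr1n.
Qed.

Lemma perspective_ray g t x : t != 0 ->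
  perspective g (t *: lift_point 1 x) = t * g x.
Proof.
by move=> t0; rewrite lift_pointZ mulr1 perspective_lift scalerA mulVf ?scale1r.
Qed.

Lemma perspective_sublinear X g : convex_function (convex_hull X) g ->
  sublinear_on (conic_hull (lift_domain X)) (perspective g).
Proof.
move=> cg; have P0 : perspective g 0 = 0.
  by rewrite -lift_point00 perspective_lift mul0r.
split=> [r _ r0 /conic_hull_liftE[->|[t [x [t0 _ ->]]]]|].
- by rewrite lift_point00 scaler0 P0 mulr0.
- have [->|r_neq0] := eqVneq r 0; first by rewrite scale0r P0 mul0r.
  have t_neq0 := lt0r_neq0 t0.
  by rewrite scalerA !perspective_ray ?mulf_neq0// mulrA.
move=> _ y /conic_hull_liftE[->|[s [x [s0 Hx ->]]]].
  by rewrite lift_point00 add0r P0 add0r.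
move=> /conic_hull_liftE[->|[t [z [t0 Hz ->]]]].
  by rewrite lift_point00 addr0 P0 addr0.
rewrite !perspective_ray ?lt0r_neq0// !lift_pointZ lift_pointD !mulr1.
by rewrite perspective_lift; exact: convex_function_weighted cg s0 t0 Hx Hz.
Qed.

(** The converse passage: convexity at weights [l], [1 - l] is subadditivity
    along two rays followed by homogeneity on each. *)
Lemma sublinear_lift_convex X p :
  sublinear_on (conic_hull (lift_domain X)) p ->
  convex_function (convex_hull X) (fun x => p (lift_point 1 x)).
Proof.
move=> [pZ pD]; apply/convex_functionP.
move=> l x y /conic_hull_lift Kx /conic_hull_lift Ky.
have [_ KZ _] := conic_hull_cone (lift_domain X).
have l1 : 0 <= 1 - l%:num by rewrite subr_ge0.
rewrite -!pZ// -[X in lift_point X (_ + _)](subrKC l%:num) -lift_pointD.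
rewrite -{1}[l%:num]mulr1 -{1}[1 - l%:num]mulr1 -!lift_pointZ.
by apply: pD; exact: KZ.
Qed.

Lemma perspective_is_largest X f (F : 'rV[R]_(1 + n) -> R) g :
  F (lift_point 0 0) = 0 ->
  (forall x, X x -> F (lift_point 1 x) = f x) ->
  is_largest_on (convex_hull X)
    [set h | convex_function (convex_hull X) h /\
             forall x, X x -> h x <= f x] g ->
  is_largest_on (conic_hull (lift_domain X))
    [set p | sublinear_on (conic_hull (lift_domain X)) p /\
             forall y, lift_domain X y -> p y <= F y] (perspective g).
Proof.
move=> F0 F1 [[cg gf] gmax]; split.
  split; first exact: perspective_sublinear.
  move=> _ [->|[x Xx <-]]; first by rewrite F0 perspective_lift mul0r.
  by rewrite F1// perspective_lift invr1 scale1r mul1r gf.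
move=> p [sp pF] y Ky; have [pZ _] := sp.
have [y0|[t [x [t0 Hx yE]]]] := conic_hull_liftE Ky.
  by rewrite y0 perspective_lift mul0r -[leRHS]F0; apply: pF; left.
rewrite yE perspective_ray ?lt0r_neq0// pZ ?(ltW t0)//; last first.
  exact: conic_hull_lift.
apply: ler_wpM2l; first exact: ltW.
apply: (gmax (fun z => p (lift_point 1 z))) => //.
split; first exact: sublinear_lift_convex.
by move=> z Xz; rewrite -F1//; apply: pF; right; exists z.
Qed.

End Cone.

Theorem proposition1 (R : realType) (n : nat) (X : set 'rV[R]_n)
    (hX : X `<=` @binary_points R n) (f : 'rV[R]_n -> R)
    (F : 'rV[R]_(1 + n) -> R)
    (hF0 : F (lift_point 0 0) = 0)
    (hF1 : forall x, X x -> F (lift_point 1 x) = f x) :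
  forall x, convex_hull X x ->
    conv_env X f x = sconv_env (lift_domain X) F (lift_point 1 x).
Proof.
move=> x Hx; have [m mf] := binary_points_bounded_below f.
have gmax := conv_env_is_largest (fun z Xz => mf z (hX z Xz)).
have Pmax := perspective_is_largest hF0 hF1 gmax.
rewrite /sconv_env (largest_on_eq Pmax (conic_hull_lift Hx)).
by rewrite perspective_lift invr1 scale1r mul1r.
Qed.
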